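(* Let $\mathcal{G}=(\mathcal{N},\mathcal{E})$ be a communication network of agents (directed and possibly disconnected), let $\mathcal{V}_i$ ($i\in\mathcal{N}$) be the agents' finite action sets, let $\mathcal{V}=\bigcup_{i\in\mathcal{N}}\mathcal{V}_i$, and let $f:2^{\mathcal{V}}\to\mathbb{R}$ be normalized, non-decreasing submodular, and 2nd-order submodular. Let $\mathrm{length}_{\#}$ and $\mathrm{length}_{s}$ be the lengths of a message containing a real number and of a message containing an action $s\in\mathcal{V}$, respectively. Then the largest inter-agent message length of the algorithm RAG described in the context is $\max(\mathrm{length}_{\#},\mathrm{length}_{s})$.
   Context: Notation. The network $\mathcal{G}=(\mathcal{N},\mathcal{E})$ is fixed during the execution of the algorithm. $\mathcal{N}_i^-=\{j\in\mathcal{N}:(j,i)\in\mathcal{E}\}$ is the set of in-neighbors of $i$ and $\mathcal{N}_i^+=\{j\in\mathcal{N}:(i,j)\in\mathcal{E}\}$ the set of out-neighbors. For $s\in\mathcal{V}$ and $\mathcal{A}\subseteq\mathcal{V}$, the marginal gain is $f(s\,|\,\mathcal{A})=f(\mathcal{A}\cup\{s\})-f(\mathcal{A})$. Function classes. $f:2^{\mathcal{V}}\to\mathbb{R}$ is normalized and non-decreasing submodular if $f(\emptyset)=0$; $f(\mathcal{A})\le f(\mathcal{B})$ whenever $\mathcal{A}\subseteq\mathcal{B}\subseteq\mathcal{V}$; and $f(s\,|\,\mathcal{A})\ge f(s\,|\,\mathcal{B})$ whenever $\mathcal{A}\subseteq\mathcal{B}\subseteq\mathcal{V}$ and $s\in\mathcal{V}$.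 It is 2nd-order submodular if $f(s\,|\,\mathcal{C})-f(s\,|\,\mathcal{A}\cup\mathcal{C})\ge f(s\,|\,\mathcal{B}\cup\mathcal{C})-f(s\,|\,\mathcal{A}\cup\mathcal{B}\cup\mathcal{C})$ for all (pairwise) disjoint $\mathcal{A},\mathcal{B},\mathcal{C}\subseteq\mathcal{V}$ and all $s\in\mathcal{V}$. Algorithm RAG (Resource-Aware distributed Greedy), run by every agent with synchronous communication. Agent $i$ keeps a set $\mathcal{I}_i$ (the agents in $\mathcal{N}_i^-$ that have selected an action) and a set $\mathcal{S}_i$ (the actions selected by the agents in $\mathcal{I}_i$), both initially empty. While agent $i$ has not selected an action $s_i^{\mathrm{RAG}}$, it repeats the following iteration: (1) $s_i\leftarrow\arg\max_{y\in\mathcal{V}_i}[f(\mathcal{S}_i\cup\{y\})-f(\mathcal{S}_i)]$ and $g_i\leftarrow f(\mathcal{S}_i\cup\{s_i\})-f(\mathcal{S}_i)$; (2) transmit $g_i$ to each agent in $\mathcal{N}_i^+\setminus\mathcal{I}_i$ and receive $g_j$ from each $j\in\mathcal{N}_i^-\setminus\mathcal{I}_i$; (3) if $i=\arg\max_{j\in(\mathcal{N}_i^-\cup\{i\})\setminus\mathcal{I}_i} g_j$, select $s_i^{\mathrm{RAG}}\leftarrow s_i$ and transmit $s_i$ to each agent in $\mathcal{N}_i^+\setminus\mathcal{I}_i$; (4) otherwise, let $\mathcal{I}_i^{\mathrm{new}}$ be the (possibly empty) set of agents $j\in\mathcal{N}_i^-\setminus\mathcal{I}_i$ that selected an action in this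 iteration, receive $s_j^{\mathrm{RAG}}$ from each $j\in\mathcal{I}_i^{\mathrm{new}}$, and set $\mathcal{I}_i\leftarrow\mathcal{I}_i\cup\mathcal{I}_i^{\mathrm{new}}$, $\mathcal{S}_i\leftarrow\mathcal{S}_i\cup\{s_j^{\mathrm{RAG}}\}_{j\in\mathcal{I}_i^{\mathrm{new}}}$. Agent $i$ returns $s_i^{\mathrm{RAG}}$. No rule for breaking ties in the argmax operations is specified. Any inter-agent message contains either a marginal gain (a real number) or an action. *)

(* Defs.v *)
From HB Require Import structures.
From mathcomp Require Import all_boot all_order all_algebra.
From mathcomp Require Import reals.

Set Implicit Arguments.
Unset Strict Implicit.
Unset Printing Implicit Defensive.

Import Order.TTheory GRing.Theory Num.Theory.
Local Open Scope ring_scope.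

Definition marginal (R : realType) (V : finType) (f : {set V} -> R)
    (s : V) (A : {set V}) : R :=
  f (s |: A) - f A.

Definition normalized_nondecreasing_submodular (R : realType) (V : finType)
    (f : {set V} -> R) : Prop :=
  [/\ f set0 = 0,
      forall A B : {set V}, A \subset B -> f A <= f B
    & forall (A B : {set V}) (s : V),
        A \subset B -> marginal f s B <= marginal f s A].

Definition second_order_submodular (R : realType) (V : finType)
    (f : {set V} -> R) : Prop :=
  forall (A B C : {set V}) (s : V),
    [disjoint A & B] -> [disjoint A & C] -> [disjoint B & C] ->
    marginal f s (B :|: C) - marginal f s (A :|: B :|: C)
      <= marginal f s C - marginal f s (A :|: C).

(* [x] is one of the maximizers of [h] over [A]: ties are left open. *)
Definition is_argmax (R : realType) (T : finType) (A : {set T}) (h : T -> R)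
    (x : T) : Prop :=
  x \in A /\ forall y, y \in A -> h y <= h x.

(* A directed network is a relation [E] on the agents, [E i j] meaning that   *)
(* (i, j) is an edge, along which i sends to j.                               *)
Definition in_nbrs (N : finType) (E : rel N) (i : N) : {set N} :=
  [set j | E j i].

Definition out_nbrs (N : finType) (E : rel N) (i : N) : {set N} :=
  [set j | E i j].

(* Local memory of agent i: [selected] is s_i^RAG once it has been selected,  *)
(* [heard] is I_i and [actions] is S_i.                                       *)
Record agent_state (N V : finType) := AgentState {
  selected : option V;
  heard : {set N};
  actions : {set V}
}.

Definition config (N V : finType) := N -> agent_state N V.

Definition init_config (N V : finType) : config N V :=
  fun=> AgentState None set0 set0.

Definition active (N V : finType) (c : config N V) (i : N) : bool :=
  selected (c i) == None.

(* The outcomes of the two argmax operations of every agent in one            *)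
(* synchronous iteration: [cand i] is s_i, and [winner i] is the maximizer    *)
(* that i finds in step (3).  As no tie-breaking rule is fixed, they are      *)
(* recorded here and only constrained, by [valid_iteration], to be maximizers.*)
(* Their values at agents that already selected an action are not used.       *)
Record iteration (N V : finType) := Iteration {
  cand : N -> V;
  winner : N -> N
}.

Definition gain (R : realType) (N V : finType) (f : {set V} -> R)
    (c : config N V) (it : iteration N V) (i : N) : R :=
  marginal f (cand it i) (actions (c i)).

(* In runs from [init_config], every agent of [in_nbrs E i :\: heard (c i)]   *)
(* is active as long as i is, so that only transmitted gains are compared.    *)
Definition valid_iteration (R : realType) (N V : finType) (E : rel N)
    (Vi : N -> {set V}) (f : {set V} -> R)
    (c : config N V) (it : iteration N V) : Prop :=
  forall i, active c i ->
    is_argmax (Vi i) (fun y => marginal f y (actions (c i))) (cand it i) /\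
    is_argmax ((i |: in_nbrs E i) :\: heard (c i)) (gain f c it) (winner it i).

Definition selects (N V : finType) (c : config N V) (it : iteration N V)
    (i : N) : bool :=
  active c i && (winner it i == i).

Definition newly_heard (N V : finType) (E : rel N) (c : config N V)
    (it : iteration N V) (i : N) : {set N} :=
  [set j in in_nbrs E i :\: heard (c i) | selects c it j].

Definition next_config (N V : finType) (E : rel N) (c : config N V)
    (it : iteration N V) : config N V :=
  fun i =>
    if ~~ active c i then c i
    else if selects c it i then
      AgentState (Some (cand it i)) (heard (c i)) (actions (c i))
    else
      AgentState None
        (heard (c i) :|: newly_heard E c it i)
        (actions (c i) :|: [set cand it j | j in newly_heard E c it i]).

Inductive message (R : realType) (V : finType) :=
  | GainMsg of R
  | ActionMsg of V.

Definition message_length (R : realType) (V : finType) (len_num len_act : R)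
    (m : message R V) : R :=
  match m with
  | GainMsg _ => len_num
  | ActionMsg _ => len_act
  end.

Definition transmits (R : realType) (N V : finType) (E : rel N)
    (f : {set V} -> R) (c : config N V) (it : iteration N V)
    (i j : N) (m : message R V) : Prop :=
  [/\ active c i,
      j \in out_nbrs E i :\: heard (c i)
    & m = GainMsg V (gain f c it i) \/
      (selects c it i /\ m = ActionMsg R (cand it i))].

Fixpoint valid_from (R : realType) (N V : finType) (E : rel N)
    (Vi : N -> {set V}) (f : {set V} -> R)
    (c : config N V) (its : seq (iteration N V)) : Prop :=
  match its with
  | [::] => True
  | it :: its' =>
      valid_iteration E Vi f c it /\
      valid_from E Vi f (next_config E c it) its'
  end.

Fixpoint transmits_from (R : realType) (N V : finType) (E : rel N)
    (f : {set V} -> R) (c : config N V) (its : seq (iteration N V))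
    (i j : N) (m : message R V) : Prop :=
  match its with
  | [::] => False
  | it :: its' =>
      transmits E f c it i j m \/
      transmits_from E f (next_config E c it) its' i j m
  end.

(* The first iterations of an execution, which need not have terminated. *)
Definition RAG_run (R : realType) (N V : finType) (E : rel N)
    (Vi : N -> {set V}) (f : {set V} -> R)
    (its : seq (iteration N V)) : Prop :=
  valid_from E Vi f (@init_config N V) its.

Definition final_config (N V : finType) (E : rel N)
    (its : seq (iteration N V)) : config N V :=
  foldl (next_config E) (@init_config N V) its.

Definition RAG_complete_run (R : realType) (N V : finType) (E : rel N)
    (Vi : N -> {set V}) (f : {set V} -> R)
    (its : seq (iteration N V)) : Prop :=
  RAG_run E Vi f its /\ forall i, ~~ active (final_config E its) i.

(* [E] may have self-loops; a message that an agent sends to itself is not an *)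
(* inter-agent message.                                                       *)
Definition inter_agent_length (R : realType) (N V : finType) (E : rel N)
    (f : {set V} -> R) (len_num len_act : R) (its : seq (iteration N V))
    (l : R) : Prop :=
  exists (i j : N) (m : message R V),
    [/\ i != j, transmits_from E f (@init_config N V) its i j m
      & l = message_length len_num len_act m].

Definition is_largest (R : realType) (P : R -> Prop) (L : R) : Prop :=
  P L /\ forall l, P l -> l <= L.

(* Main.v *)
(** An agent that is still active has heard exactly those of its in-neighbors
    that have already selected an action. Hence:
    - in the first iteration the gain of i crosses any edge (i, j);
    - the action of i also crosses that edge, unless i has heard from j before
      selecting, in which case the action of j was sent to i;
    - an active agent of globally maximal gain always wins its own comparison
      and, ties being resolved in its favor, selects, so that the number of
      active agents can be made to decrease until it vanishes. *)
Require Import Defs.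
From HB Require Import structures.
From mathcomp Require Import all_boot all_order all_algebra.
From mathcomp Require Import reals.

Set Implicit Arguments.
Unset Strict Implicit.
Unset Printing Implicit Defensive.

Import Order.TTheory GRing.Theory Num.Theory.
Local Open Scope ring_scope.

(** Restricted to active agents because [heard] is frozen once an agent selects. *)
Definition heard_inv (N V : finType) (E : rel N) (c : config N V) : Prop :=
  forall i, active c i ->
    heard (c i) = [set j in in_nbrs E i | ~~ active c j].

Lemma heard_inv_init (N V : finType) (E : rel N) :
  heard_inv E (@init_config N V).
Proof. by move=> i _; apply/setP=> j; rewrite !inE andbF. Qed.

Lemma active_next (N V : finType) (E : rel N) (c : config N V)
    (it : iteration N V) (i : N) :
  active (next_config E c it) i = active c i && ~~ selects c it i.
Proof.
rewrite [LHS]/active /next_config.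
have [ai | nai] := boolP (active c i); last exact: negbTE nai.
by case: (selects c it i).
Qed.

Lemma heard_inv_next (N V : finType) (E : rel N) (c : config N V)
    (it : iteration N V) :
  heard_inv E c -> heard_inv E (next_config E c it).
Proof.
move=> inv i; rewrite active_next => /andP[ai nsi].
rewrite /next_config ai (negbTE nsi) /= inv //.
apply/setP=> j; rewrite !inE inv // !inE active_next /selects.
by case: (E j i); case: (active c j); case: (_ == _).
Qed.

Lemma action_transmitted (R : realType) (N V : finType) (E : rel N)
    (f : {set V} -> R) (its : seq (iteration N V)) (i j : N) (c : config N V) :
    heard_inv E c -> active c i -> E i j -> j \notin heard (c i) ->
    ~~ active (foldl (next_config E) c its) i ->
  exists a, transmits_from E f c its i j (ActionMsg R a) \/
            transmits_from E f c its j i (ActionMsg R a).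
Proof.
move=> + + Eij; elim: its c => [|it its IHits] c inv ai jNi /= nai.
  by rewrite ai in nai.
have [si | nsi] := boolP (selects c it i).
  by exists (cand it i); left; left; split; rewrite ?inE ?jNi //; right.
have [newj | oldj] := boolP (j \in newly_heard E c it i).
  exists (cand it j); right; left.
  move: newj; rewrite !inE => /andP[/andP[_ Eji] sj].
  have aj : active c j by case/andP: sj.
  (* By the invariant [heard (c j)] contains only inactive agents, so the active [i] still receives
     the action of [j]. *)
  by split; rewrite ?inE ?inv ?inE ?ai ?andbF //; right.
(* Otherwise [i] stays active without having heard [j], and the induction continues. *)
have [] := IHits (next_config E c it) _ _ _ nai.
- exact: heard_inv_next.
- by rewrite active_next ai.
- by rewrite /next_config ai (negbTE nsi) inE negb_or jNi.
by move=> a [ta | ta]; exists a; [left | right]; right.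
Qed.

Lemma ex_argmax (R : realType) (T : finType) (A : {set T}) (h : T -> R) :
  A != set0 -> exists x, is_argmax A h x.
Proof.
case/set0Pn=> x0 Ax0; exists [arg max_(x > x0 in A) h x]%O.
by case: arg_maxP.
Qed.

(** Used with [x0] the agent itself: under arbitrary tie-breaking, agents with equal gains could
    name each other forever and none would select. *)
Lemma argmax_prefer (R : realType) (T : finType) (A : {set T}) (h : T -> R)
    (x0 : T) :
  A != set0 -> exists x, is_argmax A h x /\ (is_argmax A h x0 -> x = x0).
Proof.
case/(ex_argmax h)=> x [Ax hx].
have [/andP[Ax0 /forall_inP hx0] | nx0] :=
  boolP ((x0 \in A) && [forall y in A, h y <= h x0]).
  by exists x0.
exists x; split=> // -[Ax0 hx0]; case/negP: nx0.
by rewrite Ax0; apply/forall_inP.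
Qed.

Lemma ex_selecting_iteration (R : realType) (N V : finType) (E : rel N)
    (Vi : N -> {set V}) (f : {set V} -> R) (c : config N V) :
    (forall i, Vi i != set0) -> heard_inv E c -> (exists i, active c i) ->
  exists it, valid_iteration E Vi f c it /\ exists i, selects c it i.
Proof.
move=> Vi0 inv [i1 ai1].
have [cnd cndP] := fin_all_exists (fun i =>
  ex_argmax (fun y => marginal f y (actions (c i))) (Vi0 i)).
pose g i := marginal f (cnd i) (actions (c i)).
pose D i := (i |: in_nbrs E i) :\: heard (c i).
have D0 i : active c i -> D i != set0.
  by move=> ai; apply/set0Pn; exists i; rewrite !inE inv // !inE ai andbF eqxx.
have /fin_all_exists[w wP] (i : N) : exists x,
    active c i -> is_argmax (D i) g x /\ (is_argmax (D i) g i -> x = i).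
  have [ai | _] := boolP (active c i); last by exists i.
  by have [x xP] := argmax_prefer g i (D0 i ai); exists x.
exists (Iteration cnd w); split; first by move=> i /wP[].
have /(ex_argmax g)[i [ai maxi]] : [set j | active c j] != set0.
  by apply/set0Pn; exists i1; rewrite inE.
rewrite inE in ai; exists i; rewrite /selects ai /=; apply/eqP.
case: (wP i ai) => _; apply; split.
  by rewrite !inE inv // !inE ai andbF eqxx.
(* By the invariant every competitor of [i] is active, hence covered by the maximality of [g i] over
   all active agents. *)
move=> j; rewrite inE inv // !inE => /andP[jNi Dj]; apply: maxi; rewrite inE.
by case/predU1P: Dj jNi => [-> // | ->]; rewrite negbK.
Qed.

Lemma ex_terminating (R : realType) (N V : finType) (E : rel N)
    (Vi : N -> {set V}) (f : {set V} -> R) (c : config N V) :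
    (forall i, Vi i != set0) -> heard_inv E c ->
  exists its, valid_from E Vi f c its /\
    forall i, ~~ active (foldl (next_config E) c its) i.
Proof.
move=> Vi0; have [n] := ubnP #|active c|; elim: n c => // n IHn c cn inv.
have [/existsP actc | noact] := boolP [exists i, active c i]; last first.
  by exists [::]; split=> // i; move/existsPn: noact.
have [it [vit [i si]]] := ex_selecting_iteration f Vi0 inv actc.
have [|its [vits done_its]] :=
  IHn (next_config E c it) _ (heard_inv_next (it := it) inv).
  (* The set of active agents never gains a member, and it loses [i]. *)
  rewrite -ltnS (leq_trans _ cn) // ltnS; apply: proper_card.
  apply/properP; split.
    by apply/subsetP=> j; rewrite -!topredE /= active_next => /andP[].
  exists i; first by case/andP: si.
  by rewrite -topredE /= active_next si andbF.
by exists (it :: its).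
Qed.

Lemma message_length_le (R : realType) (V : finType) (len_num len_act : R)
    (m : message R V) :
  message_length len_num len_act m <= Num.max len_num len_act.
Proof. by case: m => x /=; rewrite le_max lexx ?orbT. Qed.

Theorem proposition3 (R : realType) (N V : finType) (E : rel N)
    (Vi : N -> {set V}) (f : {set V} -> R) (len_num len_act : R)
    (hV : \bigcup_(i : N) Vi i = [set: V])
    (hf : normalized_nondecreasing_submodular f)
    (hf2 : second_order_submodular f) :
  [/\ (* in every execution, terminated or not, no message is longer *)
      forall its : seq (iteration N V), RAG_run E Vi f its ->
        forall l : R, inter_agent_length E f len_num len_act its l ->
          l <= Num.max len_num len_act,
      (* in every terminated execution on a network having an edge between
         two agents, it is the largest length *)
      forall its : seq (iteration N V), RAG_complete_run E Vi f its ->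
        (exists i j : N, i != j /\ E i j) ->
        is_largest (inter_agent_length E f len_num len_act its)
                   (Num.max len_num len_act)
    & (* terminated executions exist whenever the argmax over each action set
         is defined *)
      (forall i : N, Vi i != set0) ->
        exists its : seq (iteration N V), RAG_complete_run E Vi f its].
Proof.
split=> [its _ l [i [j [m [_ _ ->]]]] | its [_ endits] [i [j [ij Eij]]] | Vi0].
- exact: message_length_le.
- split; last by move=> l [? [? [m [_ _ ->]]]]; apply: message_length_le.
  (* An action message attains the maximum if [len_num <= len_act], a gain message otherwise. *)
  have [_ | _] := leP len_num len_act.
    have [|a [ta | ta]] := action_transmitted f (@heard_inv_init N V E)
      (erefl _) Eij _ (endits i); first by rewrite inE.
    + by exists i, j, (ActionMsg R a).
    + by exists j, i, (ActionMsg R a); rewrite eq_sym.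
  (* An empty run would leave [i] active, so a first iteration exists. *)
  case: its endits => [/(_ i) // | it its _].
  exists i, j, (GainMsg V (gain f (@init_config N V) it i)).
  by split=> //; left; split; rewrite ?inE //; left.
exact: ex_terminating Vi0 (@heard_inv_init N V E).
Qed.
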